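(* For any sextuple of positive integers $(L,m,x,y,r,R)$, $$\frac{1}{(q^x,q^y,q^{rx+Ry};q^m)_L}\succcurlyeq\frac{1}{(q^{rx},q^{Ry},q^{x+y};q^m)_L}.$$
   Context: Here $q$ is a variable with $|q|<1$ (equivalently, a formal variable). Notation: for an integer $L\ge 0$, $(a;q)_L=1$ if $L=0$ and $(a;q)_L=\prod_{j=0}^{L-1}(1-aq^j)$ if $L>0$; and $(a_1,a_2,\dots,a_n;q)_L=(a_1;q)_L(a_2;q)_L\cdots(a_n;q)_L$. Thus, for example, $(q^a;q^m)_L=\prod_{j=0}^{L-1}(1-q^{a+jm})$. For two $q$-products $\Pi_1,\Pi_2$ (identified with their power series expansions in $q$), $\Pi_1\succcurlyeq\Pi_2$ means that for every $n\ge 0$ the coefficient of $q^n$ in $\Pi_1$ is at least the coefficient of $q^n$ in $\Pi_2$; equivalently, the power series of $\Pi_1-\Pi_2$ in $q$ has only nonnegative coefficients. *)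

(* Defs.v *)
From HB Require Import structures.
From mathcomp Require Import all_boot all_order all_algebra.

Set Implicit Arguments.
Unset Strict Implicit.
Unset Printing Implicit Defensive.

Import Order.TTheory GRing.Theory Num.Theory.
Local Open Scope ring_scope.

Definition qpoch (A : comNzRingType) (a q : A) (L : nat) : A :=
  \prod_(j < L) (1 - a * q ^+ j).

Definition qpochs (A : comNzRingType) (s : seq A) (q : A) (L : nat) : A :=
  \prod_(a <- s) qpoch a q L.

(* A formal power series is its sequence of coefficients. *)
Definition fps (A : Type) := nat -> A.

Definition fps_poly (A : comUnitRingType) (p : {poly A}) : fps A :=
  fun n => p`_n.

Definition fps1 (A : comUnitRingType) : fps A := fun n => (n == 0%N)%:R.

Definition fps_mul (A : comUnitRingType) (f g : fps A) : fps A :=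
  fun n => \sum_(i < n.+1) f i * g (n - i)%N.

(* [fps_inv_seq f n] lists the first [n] coefficients of 1/f, obtained by
   solving f * g = 1 degree by degree; meaningful when [f 0] is a unit. *)
Fixpoint fps_inv_seq (A : comUnitRingType) (f : fps A) (n : nat) : seq A :=
  if n is k.+1 then
    let s := fps_inv_seq f k in
    rcons s ((f 0%N)^-1 * ((k == 0%N)%:R - \sum_(i < k) f i.+1 * s`_(k - i.+1)))
  else [::].

Definition fps_inv (A : comUnitRingType) (f : fps A) : fps A :=
  fun n => (fps_inv_seq f n.+1)`_n.

Definition fps_ge (f g : fps int) : Prop := forall n, g n <= f n.

Notation "f '≽' g" := (fps_ge f g) (at level 70, no associativity).

Lemma size_fps_inv_seq (A : comUnitRingType) (f : fps A) n :
  size (fps_inv_seq f n) = n.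
Proof. by elim: n => //= n IHn; rewrite size_rcons IHn. Qed.

Lemma nth_fps_inv_seq (A : comUnitRingType) (f : fps A) n k :
  (k < n)%N -> (fps_inv_seq f n)`_k = fps_inv f k.
Proof.
elim: n => // n IHn; rewrite ltnS leq_eqVlt => /predU1P[-> // | lt_kn].
by rewrite /= nth_rcons size_fps_inv_seq lt_kn IHn.
Qed.

Lemma fps_invE (A : comUnitRingType) (f : fps A) n :
  fps_inv f n =
  (f 0%N)^-1 * ((n == 0%N)%:R - \sum_(i < n) f i.+1 * fps_inv f (n - i.+1)%N).
Proof.
rewrite {1}/fps_inv /= nth_rcons size_fps_inv_seq ltnn eqxx.
congr (_ * (_ - _)); apply: eq_bigr => i _.
by rewrite nth_fps_inv_seq // ltn_subrL /= (leq_trans _ (ltn_ord i)).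
Qed.

Lemma fps_mulV (A : comUnitRingType) (f : fps A) :
  f 0%N \is a GRing.unit -> fps_mul f (fps_inv f) =1 fps1 A.
Proof.
move=> Uf n; rewrite /fps_mul big_ord_recl subn0 /= fps_invE mulVKr //.
by rewrite subrK.
Qed.

Lemma fps_inv_uniq (A : comUnitRingType) (f g : fps A) :
  f 0%N \is a GRing.unit -> fps_mul f g =1 fps1 A -> g =1 fps_inv f.
Proof.
move=> Uf fg n; elim/ltn_ind: n => n IHn.
apply: (mulrI Uf); rewrite fps_invE mulVKr //; apply/eqP.
rewrite eq_sym subr_eq -[_%:R]/(fps1 A n) -fg /fps_mul big_ord_recl subn0 /=.
apply/eqP; congr (_ + _); apply: eq_bigr => i _; rewrite IHn //.
by rewrite ltn_subrL /= (leq_trans _ (ltn_ord i)).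
Qed.

Lemma qpochs_coef0 (s : seq nat) (m L : nat) :
  all (leq 1) s ->
  fps_poly (qpochs [seq 'X^a : {poly int} | a <- s] 'X^m L) 0%N = 1.
Proof.
move=> s_gt0; rewrite /fps_poly -horner_coef0 /qpochs horner_prod big_map.
rewrite big_seq big1 // => a /(allP s_gt0) a_gt0.
rewrite horner_prod big1 // => j _.
by rewrite !hornerE expr0n eqn0Ngt a_gt0 mul0r subr0.
Qed.

(* Main.v *)
Require Import Defs.
From HB Require Import structures.
From mathcomp Require Import all_boot all_order all_algebra.
From mathcomp Require Import ring.

Set Implicit Arguments.
Unset Strict Implicit.
Unset Printing Implicit Defensive.

Import Order.TTheory GRing.Theory Num.Theory.
Local Open Scope ring_scope.

(** Put X = q^x, Y = q^y, A = X^r, B = Y^R, and for a power Q of q^m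
<<
      d(Q)  = (1 - XQ)(1 - YQ)(1 - ABQ),
      d'(Q) = (1 - AQ)(1 - BQ)(1 - XYQ),
>>
    so that the two sides are the inverses of the products of d(q^(mj)) and of
    d'(q^(mj)) over j < L.  The idea is to exchange one factor d(Q) for d'(Q)
    at a time, which changes the inverse product by a nonnegative multiple of
    1/d(Q) - 1/d'(Q).  That difference may have negative coefficients (as a
    series in X, Y and Q it contains the term -XYQ unless r = R = 1), but it
    becomes nonnegative once multiplied by 1/d(1), and the factor 1/d(1), belonging to j = 0, is at
    hand as long as it is exchanged last ([fps_inv_swap_prod]).

    Why 1/d(1) helps: since the constant and the cubic coefficients in Q of
    d(Q) and d'(Q) agree,
<<
      d'(Q) - d(Q) = Q [(1 - A)(1 - B)(1 - XYQ) - (1 - X)(1 - Y)(1 - ABQ)],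
>>
    and 1 - A, 1 - B are 1 - X, 1 - Y times the polynomials 1 + ... + X^(r-1)
    and 1 + ... + Y^(R-1).  Hence the common factor (1 - X)(1 - Y) of the
    bracket cancels against d(1), and with T = 1 + ... + X^(r-2),
    S = 1 + ... + Y^(R-2) what is left of the bracket is
<<
      Y S (1 - XQ) + X T Y^(R-1) (1 - YQ) + X T S (1 - XYQ),
>>
    where each negative sign sits in a factor that cancels against d(Q) d'(Q)
    ([nnfrac_factor_sub]).  For the last exchange, that of d(1), the bracket
    divided by (1 - X)(1 - Y) is X T (1 - B) + Y S (1 - A), and
    1 - A and 1 - B are factors of d'(1) ([nnfrac_factor1_sub]). *)

(** * Quotients of polynomials whose expansion has nonnegative coefficients *)

Notation nnpoly := (polyOver (@Num.Def.nneg_num_pred int)).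

(** The power series N/D exists and has nonnegative coefficients.  Saying this
    through approximations modulo every 'X^n keeps all computations inside the
    commutative ring of polynomials, where [ring] applies. *)
Definition nnfrac (N D : {poly int}) : Prop :=
  forall n, exists2 G, G \is a nnpoly & exists H, N = D * G + 'X^n * H.

Lemma nnfracD N1 N2 D : nnfrac N1 D -> nnfrac N2 D -> nnfrac (N1 + N2) D.
Proof.
move=> h1 h2 n; have [G1 p1 [H1 ->]] := h1 n; have [G2 p2 [H2 ->]] := h2 n.
by exists (G1 + G2); [exact: rpredD | exists (H1 + H2); ring].
Qed.

Lemma nnfracM N1 N2 D1 D2 :
  nnfrac N1 D1 -> nnfrac N2 D2 -> nnfrac (N1 * N2) (D1 * D2).
Proof.
move=> h1 h2 n; have [G1 p1 [H1 ->]] := h1 n; have [G2 p2 [H2 ->]] := h2 n.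
exists (G1 * G2); first exact: rpredM.
exists (H1 * (D2 * G2) + H2 * (D1 * G1) + 'X^n * H1 * H2); ring.
Qed.

Lemma nnfrac11 : nnfrac 1 1.
Proof. by move=> n; exists 1; [exact: rpred1 | exists 0; ring]. Qed.

Lemma nnfrac1M D1 D2 : nnfrac 1 D1 -> nnfrac 1 D2 -> nnfrac 1 (D1 * D2).
Proof. by move=> h1 h2; rewrite -[1]mulr1; exact: nnfracM. Qed.

Lemma nnfrac1_prod n (D : 'I_n -> {poly int}) :
  (forall i, nnfrac 1 (D i)) -> nnfrac 1 (\prod_i D i).
Proof. by move=> hD; elim/big_ind: _; [exact: nnfrac11|exact: nnfrac1M|]. Qed.

Lemma nnfrac_expand E N D : nnfrac N D -> nnfrac (N * E) (D * E).
Proof.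
move=> h n; have [G pG [H ->]] := h n.
by exists G => //; exists (H * E); ring.
Qed.

(** Fractions are brought to a common denominator by expanding and never need
    to be reduced: E may have coefficients of any sign, as it cancels. *)
Lemma nnfrac_cancel P F E N D : N = P * E -> D = F * E ->
  P \is a nnpoly -> nnfrac 1 F -> nnfrac N D.
Proof.
move=> -> -> pP h; apply: nnfrac_expand => n; have [G pG [H e]] := h n.
exists (P * G); first exact: rpredM.
by exists (P * H); rewrite -[LHS]mulr1 [in LHS]e; ring.
Qed.

(** The missing constant term makes the geometric series of u converge, and
    the signs make its sum nonnegative. *)
Definition nnpoly_nocst (u : {poly int}) : Prop :=
  exists2 v, v \is a nnpoly & u = 'X * v.

Lemma nnpolyXn n : 'X^n \is a nnpoly.
Proof. by rewrite rpredX ?polyOverX. Qed.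

Lemma nnpoly_nocstXn n : (0 < n)%N -> nnpoly_nocst 'X^n.
Proof. by case: n => // n _; exists 'X^n; rewrite ?nnpolyXn ?exprS. Qed.

Lemma nnpoly_nocstM u P :
  nnpoly_nocst u -> P \is a nnpoly -> nnpoly_nocst (u * P).
Proof.
by case=> v pv -> pP; exists (v * P); rewrite ?mulrA //; exact: rpredM.
Qed.

Lemma nnpoly_nocstW u : nnpoly_nocst u -> u \is a nnpoly.
Proof. by case=> v pv ->; rewrite rpredM ?polyOverX. Qed.

Lemma nnfrac1_sub u : nnpoly_nocst u -> nnfrac 1 (1 - u).
Proof.
move=> su n; exists (\sum_(i < n) u ^+ i).
  by apply: rpred_sum => i _; apply/rpredX/nnpoly_nocstW.
case: su => v _ eu; exists (v ^+ n).
rewrite -exprMn -eu -[X in X * _]opprB mulNr -subrX1; ring.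
Qed.

(** * Comparison of inverse power series *)

Lemma modXn_coef (p q : {poly int}) n :
  (forall i, (i < n)%N -> p`_i = q`_i) -> exists H, p = q + 'X^n * H.
Proof.
move=> epq; exists (drop_poly n (p - q)).
have e0: take_poly n (p - q) = 0.
  apply/polyP=> i; rewrite coef_take_poly coef0 coefB.
  by case: ltnP => // /epq ->; rewrite subrr.
have := poly_take_drop n (p - q); rewrite e0 add0r mulrC => ->; ring.
Qed.

Lemma modXn_fps_inv D n : nnfrac 1 D ->
  exists H, D * \poly_(i < n) fps_inv (fps_poly D) i = 1 + 'X^n * H.
Proof.
(* Modulo 'X the hypothesis says that the constant coefficient is a unit. *)
move=> hD; have UD: fps_poly D 0%N \is a GRing.unit.
  have [G _ [H /(congr1 (fun p : {poly int} => p`_0))]] := hD 1.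
  rewrite coefD coefXM addr0 coef1 coef0M => e.
  by apply/unitrPr; exists G`_0.
apply: modXn_coef => k lt_kn; rewrite coefM coef1 -[RHS](fps_mulV UD k).
apply: eq_bigr => i _; rewrite coef_poly.
by rewrite (leq_ltn_trans (leq_subr _ _) lt_kn).
Qed.

(** 1/D - 1/D' = (D' - D) / (D D'), read off modulo a large power of 'X. *)
Lemma fps_inv_ge D D' : nnfrac 1 D -> nnfrac 1 D' ->
  nnfrac (D' - D) (D * D') -> fps_inv (fps_poly D) ≽ fps_inv (fps_poly D').
Proof.
move=> hD hD' hsub k; have [G pG [H eG]] := hsub k.+1.
have [W eW] := modXn_fps_inv k.+1 hD; have [W' eW'] := modXn_fps_inv k.+1 hD'.
move: eW eW'; set p := \poly_(i < _) _; set p' := \poly_(i < _) _ => eW eW'.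
have [V eV]: exists V, p - p' = G + 'X^(k.+1) * V.
  exists (p' * W - p * W' + G * (W + W') + 'X^(k.+1) * G * W * W' + H * p * p').
  have e1: p * (D' * p') - p' * (D * p)
       = (D * p) * (D' * p') * G + 'X^(k.+1) * H * p * p'.
    by transitivity ((D' - D) * p * p'); [|rewrite eG]; ring.
  rewrite eW eW' in e1.
  transitivity (p * (1 + 'X^(k.+1) * W') - p' * (1 + 'X^(k.+1) * W)
                + 'X^(k.+1) * (p' * W - p * W')); first ring.
  by rewrite e1; ring.
move/(congr1 (fun q : {poly int} => q`_k)): eV.
rewrite coefB coefD coefXnM ltnSn addr0 !coef_poly ltnSn => e.
by rewrite -subr_ge0 e; apply: (polyOverP pG).
Qed.

(** The factor 1/c, which may be needed to make 1/d - 1/d' nonnegative, is not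
    consumed and remains available for further exchanges. *)
Lemma fps_inv_swap c d d' M :
    nnfrac 1 c -> nnfrac 1 d -> nnfrac 1 d' -> nnfrac 1 M ->
    nnfrac (d' - d) (c * d * d') ->
  fps_inv (fps_poly (c * d * M)) ≽ fps_inv (fps_poly (c * d' * M)).
Proof.
move=> hc hd hd' hM hsub; apply: fps_inv_ge; try by do !apply: nnfrac1M.
have := nnfrac_expand (c * M) (nnfracM hsub hM).
set N := (N in nnfrac N); set D := (D in nnfrac _ D).
by congr (nnfrac _ _); rewrite /N /D; ring.
Qed.

(** The factor exchanged last is kept in M while the induction hypothesis
    exchanges the others. *)
Lemma fps_inv_swap_prod n c M (d d' : nat -> {poly int}) :
    nnfrac 1 c -> nnfrac 1 M ->
    (forall i, nnfrac 1 (d i)) -> (forall i, nnfrac 1 (d' i)) ->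
    (forall i, nnfrac (d' i - d i) (c * d i * d' i)) ->
  fps_inv (fps_poly (c * (M * \prod_(i < n) d i)))
  ≽ fps_inv (fps_poly (c * (M * \prod_(i < n) d' i))).
Proof.
move=> hc hM hd hd' hsub.
elim: n M hM => [|n IHn] M hM k; first by rewrite !big_ord0.
rewrite !big_ord_recr /=.
pose mid := c * (M * d n * \prod_(i < n) d' i).
apply: (@le_trans _ _ (fps_inv (fps_poly mid) k)).
  have gM : nnfrac 1 (M * \prod_(i < n) d' i).
    by apply: nnfrac1M => //; exact: nnfrac1_prod.
  have := fps_inv_swap hc (hd n) (hd' n) gM (hsub n) k.
  congr (is_true (fps_inv (fps_poly _) _ <= fps_inv (fps_poly _) _)).
    by ring.
  by rewrite /mid; ring.
rewrite (mulrC (\prod_(i < n) d i)) (mulrA M).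
by apply: IHn; exact: nnfrac1M.
Qed.

(** * Exchange of a single factor *)

Definition factor3 (u v w Q : {poly int}) :=
  (1 - u * Q) * (1 - v * Q) * (1 - w * Q).

Lemma qpochs3 u v w Q L :
  qpochs [:: u; v; w] Q L = \prod_(j < L) factor3 u v w (Q ^+ j).
Proof.
by rewrite /qpochs !big_cons big_nil mulr1 mulrA /qpoch -!big_split.
Qed.

Lemma nnfrac1_factor3 u v w Q :
  nnpoly_nocst u -> nnpoly_nocst v -> nnpoly_nocst w -> Q \is a nnpoly ->
  nnfrac 1 (factor3 u v w Q).
Proof.
by move=> hu hv hw hQ; do !apply: nnfrac1M; apply: nnfrac1_sub;
  exact: nnpoly_nocstM.
Qed.

Section FactorExchange.

(* Here U = X^(r-1) and T = 1 + X + ... + X^(r-2); likewise V and S from Y.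
   The relations eU and eV are the geometric sums. *)
Variables (X Y T U S V : {poly int}).
Hypotheses (hX : nnpoly_nocst X) (hY : nnpoly_nocst Y).
Hypotheses (nnT : T \is a nnpoly) (nnU : U \is a nnpoly).
Hypotheses (nnS : S \is a nnpoly) (nnV : V \is a nnpoly).
Hypotheses (eU : U = 1 - (1 - X) * T) (eV : V = 1 - (1 - Y) * S).

(* Notations rather than local definitions, so that [ring] sees products of
   the six variables. *)
Local Notation A := (X * U).
Local Notation B := (Y * V).
Local Notation d := (factor3 X Y (A * B)).
Local Notation d' := (factor3 A B (X * Y)).

Let nnX : X \is a nnpoly. Proof. exact: nnpoly_nocstW. Qed.
Let nnY : Y \is a nnpoly. Proof. exact: nnpoly_nocstW. Qed.
Let hA : nnpoly_nocst A. Proof. exact: nnpoly_nocstM. Qed.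
Let hB : nnpoly_nocst B. Proof. exact: nnpoly_nocstM. Qed.
Let hC : nnpoly_nocst (X * Y). Proof. exact: nnpoly_nocstM. Qed.
Let hZ : nnpoly_nocst (A * B).
Proof. by apply: nnpoly_nocstM => //; exact: nnpoly_nocstW. Qed.

(** At Q = 1 no help from another factor is needed: 1/d(1) - 1/d'(1) is the
    sum of 1/(1 - X) - 1/(1 - A) and 1/(1 - Y) - 1/(1 - B), times
    1 / ((1 - AB)(1 - XY)). *)
Lemma nnfrac_factor1_sub : nnfrac (d' 1 - d 1) (d 1 * d' 1).
Proof.
have -> : d' 1 - d 1 = X * T * ((1 - X) * (1 - Y) * (1 - B))
                       + Y * S * ((1 - X) * (1 - Y) * (1 - A)).
  by rewrite /factor3 eU eV; ring.
apply: nnfracD.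
- apply: (nnfrac_cancel (P := X * T)
           (F := (1 - A) * ((1 - A * B) * (1 - X * Y)))).
  + by [].
  + by rewrite /factor3; ring.
  + exact: rpredM.
  + by do !apply: nnfrac1M; exact: nnfrac1_sub.
- apply: (nnfrac_cancel (P := Y * S)
           (F := (1 - B) * ((1 - A * B) * (1 - X * Y)))).
  + by [].
  + by rewrite /factor3; ring.
  + exact: rpredM.
  + by do !apply: nnfrac1M; exact: nnfrac1_sub.
Qed.

(** The factor 1/d(1) makes 1/d(Q) - 1/d'(Q) nonnegative because its part
    1/((1 - X)(1 - Y)) cancels the factor (1 - X)(1 - Y) of d'(Q) - d(Q),
    after which every negative term lies in one of 1 - XQ, 1 - YQ, 1 - XYQ. *)
Lemma nnfrac_factor_sub Q : Q \is a nnpoly ->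
  nnfrac (d' Q - d Q) (d 1 * d Q * d' Q).
Proof.
move=> nnQ.
have gQ u : nnpoly_nocst u -> nnfrac 1 (1 - u * Q).
  by move=> hu; apply/nnfrac1_sub/nnpoly_nocstM.
(* The part of the denominator in which nothing cancels. *)
pose W := (1 - A * B) * ((1 - A * B * Q) * ((1 - A * Q) * (1 - B * Q))).
have gW : nnfrac 1 W.
  by apply: nnfrac1M; [exact: nnfrac1_sub | do !apply: nnfrac1M; exact: gQ].
have -> : d' Q - d Q
    = Q * Y * S * ((1 - X) * (1 - Y) * (1 - X * Q))
      + Q * X * T * V * ((1 - X) * (1 - Y) * (1 - Y * Q))
      + Q * X * T * S * ((1 - X) * (1 - Y) * (1 - X * Y * Q)).
  by rewrite /factor3 eU eV; ring.
apply: nnfracD; first apply: nnfracD.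
- apply: (nnfrac_cancel (P := Q * Y * S)
           (F := W * ((1 - Y * Q) * (1 - X * Y * Q)))).
  + by [].
  + by rewrite /factor3 /W; ring.
  + by rewrite !rpredM.
  + by do !apply: nnfrac1M => //; exact: gQ.
- apply: (nnfrac_cancel (P := Q * X * T * V)
           (F := W * ((1 - X * Q) * (1 - X * Y * Q)))).
  + by [].
  + by rewrite /factor3 /W; ring.
  + by rewrite !rpredM.
  + by do !apply: nnfrac1M => //; exact: gQ.
- apply: (nnfrac_cancel (P := Q * X * T * S)
           (F := W * ((1 - X * Q) * (1 - Y * Q)))).
  + by [].
  + by rewrite /factor3 /W; ring.
  + by rewrite !rpredM.
  + by do !apply: nnfrac1M => //; exact: gQ.
Qed.

End FactorExchange.

(** * The inequality *)

Theorem theorem1p1 (L m x y r R : nat)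
    (hL : (0 < L)%N) (hm : (0 < m)%N) (hx : (0 < x)%N) (hy : (0 < y)%N)
    (hr : (0 < r)%N) (hR : (0 < R)%N) :
  fps_inv (fps_poly (qpochs
    [:: 'X^x; 'X^y; 'X^(r * x + R * y)] ('X^m : {poly int}) L))
  ≽
  fps_inv (fps_poly (qpochs
    [:: 'X^(r * x); 'X^(R * y); 'X^(x + y)] ('X^m : {poly int}) L)).
Proof.
rewrite !qpochs3 !exprD (mulnC r) (mulnC R) !exprM.
have: nnpoly_nocst 'X^x by exact: nnpoly_nocstXn.
have: nnpoly_nocst 'X^y by exact: nnpoly_nocstXn.
move: 'X^x 'X^y => X Y hY hX; set q : {poly int} := 'X^m.
case: L r R hL hr hR => // l [//|p] [//|s] _ _ _.
have [nnX nnY] := (nnpoly_nocstW hX, nnpoly_nocstW hY).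
have nnq j : q ^+ j \is a nnpoly by rewrite rpredX ?nnpolyXn.
have nn_geom (Z : {poly int}) n :
    Z \is a nnpoly -> \sum_(i < n) Z ^+ i \is a nnpoly.
  by move=> nnZ; apply: rpred_sum => i _; exact: rpredX.
have geomE (Z : {poly int}) n : Z ^+ n = 1 - (1 - Z) * \sum_(i < n) Z ^+ i.
  by rewrite -[LHS](subrK 1) subrX1; ring.
have nnU : X ^+ p \is a nnpoly by exact: rpredX.
have nnV : Y ^+ s \is a nnpoly by exact: rpredX.
rewrite !(exprS X) !(exprS Y) !big_ord_recl !expr0.
set d := factor3 X Y _; set d' := factor3 _ _ (X * Y).
have nc u v : nnpoly_nocst u -> nnpoly_nocst v -> nnpoly_nocst (u * v).
  by move=> hu /nnpoly_nocstW; exact: nnpoly_nocstM.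
have gd Q : Q \is a nnpoly -> nnfrac 1 (d Q).
  by apply: nnfrac1_factor3 => //; apply: nc; exact: nnpoly_nocstM.
have gd' Q : Q \is a nnpoly -> nnfrac 1 (d' Q).
  by apply: nnfrac1_factor3; [exact: nnpoly_nocstM..|exact: nc].
have nn1 : (1 : {poly int}) \is a nnpoly by exact: rpred1.
move=> k; pose mid := d 1 * \prod_(i < l) d' (q ^+ i.+1).
apply: (@le_trans _ _ (fps_inv (fps_poly mid) k)).
  have := fps_inv_swap (M := \prod_(i < l) d' (q ^+ i.+1))
            nnfrac11 (gd _ nn1) (gd' _ nn1) _ _ k.
  rewrite !mul1r; apply; first by apply: nnfrac1_prod => i; exact: gd'.
  by apply: nnfrac_factor1_sub => //; exact: nn_geom.
have := @fps_inv_swap_prod l (d 1) 1 (fun i => d (q ^+ i.+1))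
          (fun i => d' (q ^+ i.+1)) (gd _ nn1) nnfrac11.
rewrite !mul1r; apply=> i; [exact: gd | exact: gd' |].
by apply: nnfrac_factor_sub => //; exact: nn_geom.
Qed.
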